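(* Let $M_1(z)=\sum_{\alpha\ne\varnothing}S(\alpha)z^{|\alpha|}$, the sum being over all nonempty integer compositions, and let $T(z)=\frac{1-z}{1-2z}$. Then, as formal power series, $$M_1(z)=T(z)\sum_{p\ge1}\frac{pz^p}{1-z^p}=\frac{1-z}{1-2z}\sum_{n\ge1}\sigma_1(n)z^n.$$
   Context: An integer composition of $n\ge1$ is an ordered sequence $\alpha=(a_1,\ldots,a_\ell)$ of integers $a_i\ge1$ with sum $n$; write $|\alpha|=n$. The initial run of $\alpha$ is the maximal prefix $(a_1,\ldots,a_k)$ whose entries are all equal; $P(\alpha)=a_1$, $K(\alpha)=k$ is the number of parts in it, and $S(\alpha)=P(\alpha)K(\alpha)$. $\sigma_1(n)=\sum_{d\mid n}d$ is the sum of the positive divisors of $n$. *)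

(* Defs.v *)
From HB Require Import structures.
From mathcomp Require Import all_boot all_order all_algebra.
From mathcomp Require Import boolp classical_sets functions cardinality fsbigop.

Set Implicit Arguments.
Unset Strict Implicit.
Unset Printing Implicit Defensive.

Import Order.TTheory GRing.Theory Num.Theory.
Local Open Scope classical_set_scope.
Local Open Scope ring_scope.

(* A wrapper record rather than [nat -> R] itself: the function space already
   carries the pointwise ring structure. *)
Record fps (R : Type) := FPS { fcoef : nat -> R }.

Lemma fpsP (R : Type) (A B : fps R) :
  (forall n, fcoef A n = fcoef B n) <-> A = B.
Proof.
split=> [|->//]; case: A B => [a] [b] /= ab; congr FPS.
exact/funext.
Qed.

HB.instance Definition _ (R : Type) := gen_eqMixin (fps R).
HB.instance Definition _ (R : Type) := gen_choiceMixin (fps R).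

Section FpsRing.
Variable R : comNzRingType.
Implicit Types A B C : fps R.

Definition fps_zero : fps R := FPS (fun=> 0).
Definition fps_opp A : fps R := FPS (fun n => - fcoef A n).
Definition fps_add A B : fps R := FPS (fun n => fcoef A n + fcoef B n).
Definition fps_one : fps R := FPS (fun n => (n == 0)%:R).
Definition fps_mul A B : fps R :=
  FPS (fun n => \sum_(i < n.+1) fcoef A i * fcoef B (n - i)%N).

Fact fps_addA : associative fps_add.
Proof. by move=> A B C; apply/fpsP=> n /=; rewrite addrA. Qed.
Fact fps_addC : commutative fps_add.
Proof. by move=> A B; apply/fpsP=> n /=; rewrite addrC. Qed.
Fact fps_add0 : left_id fps_zero fps_add.
Proof. by move=> A; apply/fpsP=> n /=; rewrite add0r. Qed.
Fact fps_addN : left_inverse fps_zero fps_opp fps_add.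
Proof. by move=> A; apply/fpsP=> n /=; rewrite addNr. Qed.

HB.instance Definition _ :=
  GRing.isZmodule.Build (fps R) fps_addA fps_addC fps_add0 fps_addN.

Definition fps_trunc n A : {poly R} := \poly_(i < n.+1) fcoef A i.

Lemma coef_fps_trunc n A i : (i <= n)%N -> (fps_trunc n A)`_i = fcoef A i.
Proof. by move=> le_in; rewrite coef_poly ltnS le_in. Qed.

Lemma fcoef_fps_mul n m A B : (m <= n)%N ->
  fcoef (fps_mul A B) m = (fps_trunc n A * fps_trunc n B)`_m.
Proof.
move=> le_mn; rewrite coefM /=; apply: eq_bigr => i _.
rewrite !coef_fps_trunc //; last by rewrite (leq_trans _ le_mn) // -ltnS.
by rewrite (leq_trans (leq_subr _ _)).
Qed.

Fact fps_mulA : associative fps_mul.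
Proof.
move=> A B C; apply/fpsP=> n.
transitivity ((fps_trunc n A * (fps_trunc n B * fps_trunc n C))`_n).
  rewrite coefM /=; apply: eq_bigr => i _.
  rewrite coef_fps_trunc; last by rewrite -ltnS.
  by rewrite -(fcoef_fps_mul _ _ (leq_subr i n)).
rewrite mulrA coefM /=; apply: eq_bigr => i _.
rewrite [X in _ * X = _]coef_fps_trunc ?leq_subr //.
by rewrite -fcoef_fps_mul // -ltnS.
Qed.

Fact fps_mulC : commutative fps_mul.
Proof.
move=> A B; apply/fpsP=> n.
by rewrite !(@fcoef_fps_mul n) // mulrC.
Qed.

Fact fps_mul1 : left_id fps_one fps_mul.
Proof.
move=> A; apply/fpsP=> n /=.
by rewrite big_ord_recl /= mul1r subn0 big1 ?addr0 // => i _; rewrite mul0r.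
Qed.

Fact fps_mulDl : left_distributive fps_mul fps_add.
Proof.
move=> A B C; apply/fpsP=> n /=.
by rewrite -big_split; apply: eq_bigr => i _; rewrite mulrDl.
Qed.

Fact fps_one_neq0 : fps_one != 0.
Proof. by apply/eqP => /fpsP /(_ 0) /= /eqP; rewrite oner_eq0. Qed.

HB.instance Definition _ := GRing.Zmodule_isComNzRing.Build (fps R)
  fps_mulA fps_mulC fps_mul1 fps_mulDl fps_one_neq0.

Definition fpsX : fps R := FPS (fun n => (n == 1)%:R).

Lemma fcoef0 n : fcoef (0 : fps R) n = 0.
Proof. by []. Qed.

Lemma fcoef1 n : fcoef (1 : fps R) n = (n == 0)%:R.
Proof. by []. Qed.

Lemma fcoefD A B n : fcoef (A + B) n = fcoef A n + fcoef B n.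
Proof. by []. Qed.

Lemma fcoefN A n : fcoef (- A) n = - fcoef A n.
Proof. by []. Qed.

Lemma fcoefMn A k n : fcoef (A *+ k) n = fcoef A n *+ k.
Proof. by elim: k => [|k IHk]; rewrite ?mulr0n // !mulrS fcoefD IHk. Qed.

Lemma fcoefM A B n :
  fcoef (A * B) n = \sum_(i < n.+1) fcoef A i * fcoef B (n - i)%N.
Proof. by []. Qed.

Lemma fcoefMX A n :
  fcoef (fpsX * A) n = if n is m.+1 then fcoef A m else 0.
Proof.
rewrite fcoefM; case: n => [|n]; first by rewrite big_ord1 mul0r.
rewrite big_ord_recl mul0r add0r big_ord_recl mul1r subSS subn0.
by rewrite big1 ?addr0 // => i _; rewrite mul0r.
Qed.

Lemma fcoefXnM A k n :
  fcoef (fpsX ^+ k * A) n = if (n < k)%N then 0 else fcoef A (n - k)%N.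
Proof.
elim: k n => [|k IHk] n; first by rewrite expr0 mul1r subn0.
by rewrite exprS -mulrA fcoefMX; case: n => // n; rewrite IHk ltnS subSS.
Qed.

Lemma fcoefXn k n : fcoef (fpsX ^+ k) n = (n == k)%:R.
Proof.
by rewrite -[_ ^+ _]mulr1 fcoefXnM fcoef1 subn_eq0; case: ltngtP.
Qed.

End FpsRing.

Arguments fpsX {R}.

Section FpsInverse.
Variable R : comUnitRingType.
Implicit Types A B : fps R.

Fixpoint fps_inv_seq A n : seq R :=
  let b0 := (fcoef A 0)^-1 in
  if n is m.+1 then
    let s := fps_inv_seq A m in
    rcons s (- b0 * \sum_(i < n) s`_i * fcoef A (n - i)%N)
  else [:: b0].

Definition fps_unit : pred (fps R) := [pred A | fcoef A 0 \is a GRing.unit].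

(* A non-unit is its own inverse, as everywhere in [unitRingType]. *)
Definition fps_inv A : fps R :=
  if A \in fps_unit then FPS (fun n => (fps_inv_seq A n)`_n) else A.

Lemma size_fps_inv_seq A n : size (fps_inv_seq A n) = n.+1.
Proof. by elim: n => //= n IHn; rewrite size_rcons IHn. Qed.

Lemma nth_fps_inv_seq A n i : (i <= n)%N ->
  (fps_inv_seq A n)`_i = (fps_inv_seq A i)`_i.
Proof.
elim: n => [|n IHn]; first by rewrite leqn0 => /eqP->.
rewrite leq_eqVlt => /orP[/eqP->//|lt_in].
by rewrite -IHn //= nth_rcons size_fps_inv_seq lt_in.
Qed.

Fact fps_mulVx : {in fps_unit, left_inverse 1 fps_inv *%R}.
Proof.
move=> A A0; rewrite /fps_inv A0; apply/fpsP=> -[|n] /=.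
  by rewrite big_ord1 mulVr.
rewrite big_ord_recr subnn /= nth_rcons size_fps_inv_seq ltnn eqxx.
rewrite mulNr mulNr mulrAC mulVr // mul1r.
apply/eqP; rewrite subr_eq0; apply/eqP/eq_bigr => i _.
by rewrite [in RHS]nth_fps_inv_seq // -ltnS.
Qed.

Fact fps_unitPl A B : B * A = 1 -> A \in fps_unit.
Proof.
move=> /fpsP /(_ 0); rewrite fcoefM big_ord1 => BA.
by apply/unitrPr; exists (fcoef B 0); rewrite mulrC BA.
Qed.

Fact fps_inv_out : {in [predC fps_unit], fps_inv =1 id}.
Proof. by move=> A /negbTE A0; rewrite /fps_inv A0. Qed.

HB.instance Definition _ := GRing.ComNzRing_hasMulInverse.Build (fps R)
  fps_mulVx fps_unitPl fps_inv_out.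

Lemma fps_unitE A : (A \is a GRing.unit) = (fcoef A 0 \is a GRing.unit).
Proof. by []. Qed.

End FpsInverse.

(* Sum of a family of power series in the usual (coefficientwise) sense. It is
   meaningful for locally finite families only: [\sum_(i \in D)] returns 0 on
   an infinite support. *)
Definition locally_finite (R : comNzRingType) (I : choiceType) (D : set I)
    (F : I -> fps R) : Prop :=
  forall n, finite_set [set i | D i /\ fcoef (F i) n <> 0].

Definition fps_sum (R : comNzRingType) (I : choiceType) (D : set I)
    (F : I -> fps R) : fps R :=
  FPS (fun n => \sum_(i \in D) fcoef (F i) n).

Definition is_composition (alpha : seq nat) : bool :=
  all (fun a => 0 < a)%N alpha.

Definition initial_run (alpha : seq nat) : seq nat :=
  take (\max_(k < (size alpha).+1 | constant (take k alpha)) k) alpha.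

Definition run_part (alpha : seq nat) : nat := head 0 alpha.
Definition run_length (alpha : seq nat) : nat := size (initial_run alpha).
Definition run_sum (alpha : seq nat) : nat :=
  (run_part alpha * run_length alpha)%N.

Definition nonempty_compositions : set (seq nat) :=
  [set alpha | is_composition alpha /\ alpha <> [::]].

Definition sigma1 (n : nat) : nat := (\sum_(d <- divisors n) d)%N.

Definition M1 : fps int :=
  fps_sum nonempty_compositions
    (fun alpha => (run_sum alpha)%:R * fpsX ^+ sumn alpha).

Definition T : fps int := (1 - fpsX) / (1 - 2%:R * fpsX).

Lemma locally_finite_ord (R : comNzRingType) (D : set nat) (F : nat -> fps R) :
    (forall p n, (n < p)%N -> fcoef (F p) n = 0) -> locally_finite D F.
Proof.
move=> F0 n; apply: (sub_finite_set _ (finite_II n.+1)) => p [_ Fp] /=.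
by rewrite ltnS leqNgt; apply/negP => /F0.
Qed.

Lemma locally_finite_sigma1 :
  locally_finite [set n | (1 <= n)%N]
    (fun n => (sigma1 n)%:R * fpsX ^+ n : fps int).
Proof.
by apply: locally_finite_ord => p n lt_np; rewrite mulrC fcoefXnM lt_np.
Qed.

Lemma locally_finite_lambert :
  locally_finite [set p | (1 <= p)%N]
    (fun p => p%:R * fpsX ^+ p / (1 - fpsX ^+ p) : fps int).
Proof.
apply: locally_finite_ord => p n lt_np.
by rewrite mulrAC mulrC fcoefXnM lt_np.
Qed.

Lemma unit_T_denom : (1 - 2%:R * fpsX : fps int) \is a GRing.unit.
Proof.
by rewrite fps_unitE fcoefD fcoefN mulr_natl fcoefMn /= mul0rn subr0 unitr1.
Qed.

Lemma unit_lambert_denom p : (0 < p)%N ->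
  (1 - fpsX ^+ p : fps int) \is a GRing.unit.
Proof.
by move=> p0; rewrite fps_unitE fcoefD fcoefN fcoefXn eq_sym gtn_eqF ?subr0.
Qed.

Lemma finite_compositions n :
  finite_set [set alpha | is_composition alpha /\ sumn alpha = n].
Proof.
have [m] := ubnP n; elim: m n => // m IHm n; rewrite ltnS => le_nm.
pose tails := \bigcup_(a in [set a | (0 < a <= n)%N])
  [set a :: beta | beta in
     [set beta | is_composition beta /\ sumn beta = (n - a)%N]].
apply: (@sub_finite_set _ _ ([set [::]] `|` tails)).
  move=> [|a beta] /= [comp sum_n]; [by left|right].
  move: comp => /andP[a0 comp]; exists a; first by rewrite /= a0 -sum_n leq_addr.
  by exists beta => //; split=> //; rewrite -sum_n addKn.
rewrite finite_setU; split; first exact: finite_set1.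
apply: bigcup_finite.
  by apply: (sub_finite_set _ (finite_II n.+1)) => a /= /andP[].
move=> a /= /andP[a0 le_an]; apply/finite_image/IHm.
by apply: leq_trans le_nm; rewrite ltn_subrL a0 (leq_trans a0).
Qed.

Lemma locally_finite_M1 :
  locally_finite nonempty_compositions
    (fun alpha => (run_sum alpha)%:R * fpsX ^+ sumn alpha : fps int).
Proof.
move=> n; apply: sub_finite_set (finite_compositions n) => alpha [[comp _]] nz.
split=> //; apply/eqP; apply: contra_notT nz => ne.
by rewrite mulr_natl fcoefMn fcoefXn eq_sym (negbTE ne) mul0rn.
Qed.

(* Main.v *)
Require Import Defs.
From mathcomp Require Import all_boot all_order all_algebra.
From mathcomp Require Import boolp classical_sets functions cardinality fsbigop.

(** The sum [S(alpha)] of the initial run of a composition [alpha] is counted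
    by its prefixes: if the run consists of [k] copies of [p], then the
    constant nonempty words [d^j] that are prefixes of [alpha] are exactly
    [p^1, ..., p^k], so [S(alpha) = p k] is the sum of [d] over all such words
    ([run_sum_prefix]).  Indexing the words [d^j] by their sum [m = d j], the
    words of sum [m] correspond to the divisors [d] of [m].

    Exchanging the two sums, each word [d^j] of sum [m] is a prefix of as many
    compositions of [n] as there are compositions of [n - m], since removing
    the prefix leaves an arbitrary composition ([count_prefix]).  Hence the
    coefficient of [z^n] in [M1] is the convolution of [sigma1] with the number
    of compositions ([sum_run_sum]).

    The generating function of the number of compositions is [T], because this
    number is 1 for [n = 0, 1] and doubles at every later step ([T_size_comps]).
    Finally [z^p / (1 - z^p)] is the indicator series of the nonzero multiples
    of [p] ([fcoef_lambert]), so the Lambert series has coefficients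
    [sigma1]. *)

Import Order.TTheory GRing.Theory Num.Theory.
Local Open Scope classical_set_scope.
Local Open Scope ring_scope.

(** * Enumeration of compositions *)

Definition incr_head (s : seq nat) : seq nat :=
  if s is a :: t then a.+1 :: t else [::].

(** A composition of [n >= 2] either starts with 1, or comes from a
    composition of [n - 1] by incrementing its first part. This recursion makes
    the doubling of the number of compositions evident. *)
Fixpoint comps (n : nat) : seq (seq nat) :=
  match n with
  | 0 => [:: [::]]
  | 1 => [:: [:: 1%N]]
  | m.+1 => map (cons 1%N) (comps m) ++ map incr_head (comps m)
  end.

Lemma size_comps n : size (comps n.+2) = (2 * size (comps n.+1))%N.
Proof. by rewrite [comps _]/= size_cat !size_map mul2n addnn. Qed.

Lemma mem_comps n (s : seq nat) :
  (s \in comps n) = is_composition s && (sumn s == n).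
Proof.
elim: n s => [|[|n] IHn] s.
- case: s => [|[|a] s] //=; rewrite inE; apply/esym/negbTE.
  by rewrite negb_and orbT.
- case: s => [|[|[|a]] [|[|b] s]] //=; rewrite ?inE //=.
  + by rewrite andbF.
  + by rewrite !addSn !eqSS andbF.
- rewrite [comps _]/= mem_cat.
  apply/orP/andP=> [[] /mapP[t]|].
  + by rewrite IHn => /andP[ct /eqP st] ->; rewrite /= st.
  + rewrite IHn => /andP[]; case: t => [|a t] //= /andP[a0 ct] st ->.
    by rewrite /= ct addSn eqSS.
  + case: s => [|[|[|a]] s] [] //= cs ss.
      by left; apply/mapP; exists s; rewrite // IHn cs.
    by right; apply/mapP; exists (a.+1 :: s); rewrite // IHn /= cs.
Qed.

Lemma uniq_comps n : uniq (comps n).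
Proof.
elim: n => [|[|n] IHn] //; rewrite [comps _]/= cat_uniq.
rewrite map_inj_uniq ?IHn /=; last by move=> s t [].
apply/andP; split.
  apply/hasPn => x /mapP[s]; rewrite -/(comps n.+1) mem_comps.
  case: s => [|[|a] s] //= _ ->.
  by apply/negP => /mapP[t _ []].
rewrite map_inj_in_uniq // => s t; rewrite -/(comps n.+1) !mem_comps.
by case: s t => [|a s] [|b t] //= _ _ [-> ->].
Qed.

Lemma is_composition_nseq j d : (0 < d)%N -> is_composition (nseq j d).
Proof. by move=> d0; rewrite /is_composition all_nseq d0 orbT. Qed.

(** Prepending [d^j] is a bijection from the compositions of the
    remainder to the compositions with that prefix. *)
Lemma count_prefix n j d : (0 < d)%N -> (d * j <= n)%N ->
  count (prefix (nseq j d)) (comps n) = size (comps (n - d * j)).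
Proof.
move=> d0 le_n; rewrite -size_filter -(size_map (cat (nseq j d))).
apply/perm_size/uniq_perm; rewrite ?filter_uniq ?uniq_comps //.
  rewrite map_inj_uniq ?uniq_comps // => s t /eqP.
  by rewrite eqseq_cat // => /andP[_ /eqP].
move=> s; rewrite mem_filter mem_comps.
apply/andP/mapP => [[/prefixP[t ->]]|[t]].
  rewrite /is_composition all_cat sumn_cat sumn_nseq.
  move=> /andP[/andP[_ ct] /eqP st].
  by exists t; rewrite // mem_comps /is_composition ct -st addKn eqxx.
rewrite mem_comps => /andP[ct /eqP st] ->; split; first exact: prefix_prefix.
rewrite /is_composition all_cat -!/(is_composition _) ct.
by rewrite is_composition_nseq //= sumn_cat sumn_nseq st subnKC.
Qed.

(** * Constant prefixes and the initial run *)

Lemma prefix_nseq_head (j p a : nat) (s : seq nat) : (0 < j)%N ->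
  prefix (nseq j p) (a :: s) -> p = a.
Proof. by case: j => //= j _ /andP[/eqP]. Qed.

Lemma constant_take (p : nat) (s : seq nat) j : (j <= (size s).+1)%N ->
  constant (take j (p :: s)) = prefix (nseq j p) (p :: s).
Proof.
move=> le_j; rewrite prefixE size_nseq; case: j le_j => //= j le_j.
have sz : size (take j s) = j by rewrite size_takel.
apply/all_pred1P/eqP => [->|[->]]; first by rewrite sz.
by rewrite size_nseq.
Qed.

(** The maximum that defines the initial run is attained, and constancy passes
    to shorter prefixes. *)
Lemma prefix_nseq_run (p : nat) (s : seq nat) j :
  prefix (nseq j p) (p :: s) = (j <= run_length (p :: s))%N.
Proof.
rewrite /run_length /initial_run.
set K := \max_(k < _ | _) k.
have le_K : (K <= (size s).+1)%N by apply/bigmax_leqP => i _; rewrite -ltnS.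
have constK : constant (take K (p :: s)).
  rewrite /K; have [|i Ci ->] // := @eq_bigmax_cond _
    [pred k : 'I_(size (p :: s)).+1 | constant (take k (p :: s))]
    (@nat_of_ord _).
  by apply/card_gt0P; exists ord0; rewrite !inE take0.
rewrite size_takel //; apply/idP/idP => [pre|le_jK].
  have le_j : (j <= (size s).+1)%N.
    by have := size_prefix pre; rewrite size_nseq.
  have lt_j : (j < (size (p :: s)).+1)%N by rewrite ltnS.
  apply: (@leq_bigmax_cond _
    (fun k : 'I_(size (p :: s)).+1 => constant (take k (p :: s)))
    (@nat_of_ord _) (Ordinal lt_j)).
  by rewrite /= -/(take j (p :: s)) constant_take.
rewrite constant_take // in constK.
apply: prefix_trans constK; rewrite -(subnKC le_jK) nseqD.
exact: prefix_prefix.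
Qed.

(** The run sum as the sum of the letters [d] of all nonempty constant
    prefixes [d^j], grouped by the sum [m = d j] of the prefix. *)
Lemma run_sum_prefix n s : is_composition s -> sumn s = n ->
  run_sum s = (\sum_(1 <= m < n.+1) \sum_(d <- divisors m)
                 d * prefix (nseq (m %/ d) d) s)%N.
Proof.
case: s => [|p s] cs sn.
  by rewrite -sn /= big_geq.
have p0 : (0 < p)%N by case/andP: cs.
pose k := run_length (p :: s).
have le_n : (p * k <= n)%N.
  have : prefix (nseq k p) (p :: s) by rewrite prefix_nseq_run.
  by case/prefixP=> t def_s; rewrite -sn def_s sumn_cat sumn_nseq leq_addr.
(* The multiples of [p] up to [p k] are the sums of the prefixes. *)
have -> : run_sum (p :: s) =
    (\sum_(1 <= m < n.+1) if (p %| m) && (m < (p * k).+1) then p else 0)%N.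
  rewrite -big_mkcond -(big_nat_widen 1 (p * k).+1 n.+1 (dvdn p)) //.
  have := divn_count_dvd p (p * k); rewrite mulKn // => def_k.
  rewrite /run_sum -/k {1}def_k big_distrr /= [RHS]big_mkcond /=.
  by apply: eq_bigr => m _; case: dvdn; rewrite ?muln1 ?muln0.
apply: eq_big_nat => m /andP[m0 _].
have zero d : d \in divisors m -> d != p ->
    (d * prefix (nseq (m %/ d) d) (p :: s) = 0)%N.
  rewrite -dvdn_divisors // => dm ne_dp.
  case pre: (prefix _ _); last by rewrite muln0.
  have j0 : (0 < m %/ d)%N by rewrite divn_gt0 ?(dvdn_gt0 m0) // dvdn_leq.
  by rewrite (prefix_nseq_head _ _ _ _ j0 pre) eqxx in ne_dp.
have [pm|npm] := boolP (p %| m)%N.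
  rewrite (bigD1_seq p) ?divisors_uniq -?dvdn_divisors //.
  rewrite big1_seq => [|d /andP[ne_dp /zero]]; last by apply.
  rewrite [RHS]addn0 prefix_nseq_run -/k ltnS.
  rewrite -[in X in (X <= p * k)%N](divnK pm) mulnC leq_pmul2l //.
  by case: leq; rewrite ?muln1 ?muln0.
rewrite big1_seq // => d /andP[_ dm]; apply: zero => //.
by apply: contraNneq npm => <-; rewrite dvdn_divisors.
Qed.

(** Double counting of the pairs of a composition of [n] and a nonempty constant
    prefix of it, weighted by the letter of the prefix. *)
Lemma sum_run_sum n :
  (\sum_(s <- comps n) run_sum s =
   \sum_(1 <= m < n.+1) sigma1 m * size (comps (n - m)))%N.
Proof.
transitivity (\sum_(s <- comps n) \sum_(1 <= m < n.+1)
    \sum_(d <- divisors m) d * prefix (nseq (m %/ d) d) s)%N.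
  apply: eq_big_seq => s; rewrite mem_comps => /andP[cs /eqP sn].
  exact: run_sum_prefix.
rewrite exchange_big /=; apply: eq_big_nat => m /andP[m0 le_mn].
rewrite exchange_big /= big_distrl /=; apply: eq_big_seq => d.
rewrite -dvdn_divisors // => dm.
have dj : (d * (m %/ d) = m)%N by rewrite mulnC divnK.
rewrite -big_distrr /= -[in RHS]dj -count_prefix ?dj //; last first.
  exact: dvdn_gt0 dm.
by rewrite -sum1_count [in RHS]big_mkcond /=.
Qed.

(** * Passage to power series *)

(** Clearing the denominator turns the identity into the doubling recurrence of
    the number of compositions. *)
Lemma T_size_comps : T = FPS (fun n => (size (comps n))%:R).
Proof.
apply: (canLR (mulrK unit_T_denom)); apply/fpsP=> n.
rewrite mulrC mulrBl mul1r -mulrA !fcoefD !fcoefN mulr_natl fcoefMn fcoefMX.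
rewrite fcoef1.
case: n => [|[|n]]; rewrite ?mul0rn //.
by rewrite /fcoef size_comps natrM mulr_natl !subrr.
Qed.

(** The bridge from sums over infinite sets to finite sums over sequences; [r]
    may contain indices that do not contribute in degree [n]. *)
Lemma fcoef_fps_sum (R : comNzRingType) (I : choiceType) (D : set I)
    (F : I -> fps R) (n : nat) (r : seq I) :
    uniq r -> (forall i, i \in r -> D i) ->
    (forall i, D i -> i \notin r -> fcoef (F i) n = 0) ->
  fcoef (fps_sum D F) n = \sum_(i <- r) fcoef (F i) n.
Proof.
move=> uniq_r rD F0; rewrite fsbig_seq //.
apply/esym/fsbig_widen => [i /rD //|].
by move=> i [Di /negP nri]; apply: F0.
Qed.

Lemma fcoef_natXn (R : comNzRingType) a k n :
  fcoef (a%:R * fpsX ^+ k : fps R) n = if n == k then a%:R else 0.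
Proof. by rewrite mulr_natl fcoefMn fcoefXn; case: eqP; rewrite ?mul0rn. Qed.

(** [z^p / (1 - z^p)] is the geometric series in [z^p] without its constant
    term. *)
Lemma fcoef_lambert p n : (0 < p)%N ->
  fcoef (p%:R * fpsX ^+ p / (1 - fpsX ^+ p) : fps int) n =
  if (0 < n)%N && (p %| n)%N then p%:R else 0.
Proof.
move=> p0.
have -> : (p%:R * fpsX ^+ p / (1 - fpsX ^+ p) : fps int) =
    p%:R * FPS (fun n => ((0 < n)%N && (p %| n)%N)%:R).
  rewrite -mulrA; congr (_ * _).
  apply: (canLR (mulrK (unit_lambert_denom p0))); apply/fpsP=> m.
  rewrite mulrC mulrBl mul1r fcoefD fcoefN fcoefXnM fcoefXn /=.
  case: (ltngtP m p) => [lt_mp|lt_pm|->].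
  - by case: m lt_mp => [|m] lt_mp; rewrite subr0 // gtnNdvd.
  - rewrite subn_gt0 lt_pm (ltn_trans p0 lt_pm) /=.
    by rewrite dvdn_subl ?(ltnW lt_pm) // subrr.
  - by rewrite subnn p0 dvdnn subr0.
by rewrite mulr_natl fcoefMn /=; case: (_ && _); rewrite ?mul0rn.
Qed.

Lemma fcoef_sum_sigma1 n :
  fcoef (fps_sum [set n : nat | (1 <= n)%N]
     (fun n => (sigma1 n)%:R * fpsX ^+ n : fps int)) n =
  if (0 < n)%N then (sigma1 n)%:R else 0.
Proof.
case: n => [|n].
  rewrite (@fcoef_fps_sum _ _ _ _ _ [::]) ?big_nil // => i i0 _.
  by rewrite fcoef_natXn ltn_eqF.
rewrite (@fcoef_fps_sum _ _ _ _ _ [:: n.+1]) //.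
- by rewrite big_seq1 fcoef_natXn eqxx.
- by move=> i; rewrite inE => /eqP->.
- by move=> i _; rewrite inE fcoef_natXn eq_sym => /negbTE->.
Qed.

Lemma lambert_sigma1 :
  fps_sum [set p : nat | (1 <= p)%N]
    (fun p => p%:R * fpsX ^+ p / (1 - fpsX ^+ p) : fps int) =
  fps_sum [set n : nat | (1 <= n)%N] (fun n => (sigma1 n)%:R * fpsX ^+ n).
Proof.
apply/fpsP=> -[|n]; rewrite fcoef_sum_sigma1.
  rewrite (@fcoef_fps_sum _ _ _ _ _ [::]) ?big_nil // => i i0 _.
  by rewrite fcoef_lambert.
rewrite (@fcoef_fps_sum _ _ _ _ _ (divisors n.+1)) ?divisors_uniq //.
- rewrite /sigma1 natr_sum; apply: eq_big_seq => d.
  rewrite -dvdn_divisors // => dn.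
  by rewrite fcoef_lambert ?dn ?(dvdn_gt0 _ dn).
- by move=> d; rewrite -dvdn_divisors // => dn; apply: dvdn_gt0 dn.
- move=> d d0; rewrite -dvdn_divisors // => /negbTE nd.
  by rewrite fcoef_lambert // nd.
Qed.

Lemma fcoef_M1 n : fcoef M1 n = (\sum_(s <- comps n) run_sum s)%:R.
Proof.
rewrite (@fcoef_fps_sum _ _ _ _ _ [seq s <- comps n | s != [::]]).
- rewrite big_filter natr_sum big_mkcond; apply: eq_big_seq => s.
  rewrite mem_comps => /andP[_ /eqP sn].
  by rewrite fcoef_natXn sn eqxx; case: s {sn}.
- by rewrite filter_uniq ?uniq_comps.
- by move=> s; rewrite mem_filter mem_comps => /and3P[/eqP nz cs _].
- move=> s [cs /eqP nz]; rewrite mem_filter nz mem_comps cs !andTb => ne.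
  by rewrite fcoef_natXn eq_sym (negbTE ne).
Qed.

Lemma M1_sigma1 :
  M1 = T * fps_sum [set n : nat | (1 <= n)%N]
             (fun n => (sigma1 n)%:R * fpsX ^+ n).
Proof.
apply/fpsP=> n; rewrite mulrC fcoefM fcoef_M1 sum_run_sum natr_sum.
rewrite big_ord_recl fcoef_sum_sigma1 mul0r add0r big_add1 big_mkord.
by apply: eq_bigr => i _; rewrite fcoef_sum_sigma1 T_size_comps natrM.
Qed.

Theorem theorem6p1 :
  M1 = T * fps_sum [set p : nat | (1 <= p)%N]
             (fun p => p%:R * fpsX ^+ p / (1 - fpsX ^+ p))
  /\
  T * fps_sum [set p : nat | (1 <= p)%N]
        (fun p => p%:R * fpsX ^+ p / (1 - fpsX ^+ p))
  = (1 - fpsX) / (1 - 2%:R * fpsX)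
    * fps_sum [set n : nat | (1 <= n)%N]
        (fun n => (sigma1 n)%:R * fpsX ^+ n).
Proof. by rewrite lambert_sigma1 -M1_sigma1. Qed.
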